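(* The set $\mathbb{P}\subset\mathbb{R}$ of prime numbers is strongly nonconvex and therefore not MICP representable.
   Context: $\mathbb{N}=\{0,1,2,\dots\}$. A set $S\subseteq\mathbb{R}^n$ is strongly nonconvex if there exists an infinite subset $R\subseteq S$ such that for all pairs of distinct points $x,y\in R$, $\frac{x+y}{2}\notin S$. A set $S\subseteq\mathbb{R}^n$ is MICP representable if there exist $p,d\in\mathbb{N}$ and a closed convex set $M\subseteq\mathbb{R}^{n+p+d}$, with variables $(x,y,z)\in\mathbb{R}^n\times\mathbb{R}^p\times\mathbb{R}^d$, such that $S=\{x\in\mathbb{R}^n : \exists y\in\mathbb{R}^p,\ \exists z\in\mathbb{Z}^d,\ (x,y,z)\in M\}$. *)

(* Defs.v *)
From mathcomp Require Import all_boot all_order all_algebra.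
From mathcomp Require Import all_classical all_reals all_analysis.

Set Implicit Arguments.
Unset Strict Implicit.
Unset Printing Implicit Defensive.

Import Order.TTheory GRing.Theory Num.Theory.
Import numFieldNormedType.Exports.

Local Open Scope classical_set_scope.
Local Open Scope ring_scope.

(* R^n is rendered as the row vectors 'rV[R]_n, whose library topology is the
   usual one: the product topology, equivalently that of the sup norm. *)

Definition strongly_nonconvex (R : realType) (n : nat) (S : set 'rV[R]_n) :
    Prop :=
  exists T : set 'rV[R]_n,
    [/\ T `<=` S, infinite_set T &
        forall x y, T x -> T y -> x <> y -> ~ S (2^-1 *: (x + y))].

Definition MICP_representable (R : realType) (n : nat) (S : set 'rV[R]_n) :
    Prop :=
  exists (p d : nat) (M : set 'rV[R]_(n + p + d)),
    [/\ closed M, convex_set M &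
        S = [set x | exists (y : 'rV[R]_p) (z : 'rV[int]_d),
               M (row_mx (row_mx x y) (map_mx intr z))]].

(* The real line is identified with 'rV[R]_1. *)
Definition prime_numbers (R : realType) : set 'rV[R]_1 :=
  [set const_mx p%:R | p in [set p : nat | prime p]].
Arguments prime_numbers : clear implicits.

(* Main.v *)
(* If p = 1 mod 4 is prime, then (p + 1)/2 > 1 divides (p + q)/2 as soon as
   q = 1 mod 4(p + 1).  Hence a sequence of primes, starting at 5, in which each
   term is 1 modulo 4(p + 1) for all earlier terms p has only composite averages.
   Primes that are 1 mod m exist for every m: every prime divisor of the value of
   the m-th cyclotomic polynomial at a multiple of m is one. *)

Require Import Defs.
From mathcomp Require Import all_boot all_order all_algebra all_field.
From mathcomp Require Import zify ring.
From mathcomp Require Import all_classical all_reals all_analysis.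

Set Implicit Arguments.
Unset Strict Implicit.
Unset Printing Implicit Defensive.

Import Order.TTheory GRing.Theory Num.Theory.
Local Open Scope ring_scope.

(* Modulo a prime p, if 'Phi_m vanishes at an element of order d < m, then this
   identity, evaluated there, reads m/d = 0 mod p. *)
Lemma Cyclotomic_dvd_sum_expX (d m : nat) :
    (0 < m)%N -> (d %| m)%N -> (d < m)%N ->
  exists Q : {poly int}, \sum_(i < m %/ d) 'X^d ^+ i = 'Phi_m * Q.
Proof.
move=> m_gt0 dm lt_dm.
have d_gt0 : (0 < d)%N by rewrite (dvdn_gt0 m_gt0).
(* The sum is (X^m - 1)/(X^d - 1), the product of ['Phi_e] over the divisors e of [m] not dividing
   [d]; since d < m, the index [m] is among them. *)
exists (\prod_(e <- divisors m | (e != m) && ~~ (e %| d)%N) 'Phi_e).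
have Xd1_neq0 : 'X^d - 1 != 0 :> {poly int}.
  exact: monic_neq0 (monicXnsubC 1 d_gt0).
apply: (mulfI Xd1_neq0); rewrite -subrX1 -exprM mulnC divnK //.
rewrite -(prod_Cyclotomic m_gt0) (bigD1_seq m) ?divisors_uniq //=; last first.
  by rewrite -dvdn_divisors.
rewrite (bigID (fun e => e %| d)%N) /= mulrCA; congr (_ * _).
rewrite -(prod_Cyclotomic d_gt0) -big_filter; apply: perm_big.
apply: uniq_perm; rewrite ?filter_uniq ?divisors_uniq // => e.
rewrite mem_filter -!dvdn_divisors //.
apply/andP/idP => [[/andP[]]//|ed].
split; last exact: dvdn_trans ed dm.
by rewrite ed andbT; apply: contraTneq ed => ->; rewrite gtnNdvd.
Qed.

(** The order [d] of [a] in ['F_p] divides [m], as ['Phi_m] divides X^m - 1, and divides p - 1 by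
    Fermat. If it were smaller than [m], then [p] would divide m/d, hence [m]. *)
Lemma prime_dvd_Cyclotomic (p m : nat) (a : int) :
    (0 < m)%N -> prime p -> ~~ (p %| m)%N -> (p %| ('Phi_m).[a])%Z ->
  (m %| p.-1)%N.
Proof.
move=> m_gt0 p_pr pNm p_dvd.
have Fp0 (n : int) : (p %| n)%Z = (n%:~R == 0 :> 'F_p).
  exact: dvdz_pcharf (pchar_Fp p_pr) n.
pose x : 'F_p := a%:~R.
have Phi0 : (('Phi_m).[a])%:~R = 0 :> 'F_p by apply/eqP; rewrite -Fp0.
have xm : x ^+ m = 1.
  apply/eqP; rewrite -subr_eq0.
  have := congr1 (fun q : {poly int} => q.[a]%:~R : 'F_p)
    (prod_Cyclotomic m_gt0).
  rewrite (bigD1_seq m) ?divisors_uniq -?dvdn_divisors //=.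
  by rewrite !hornerE rmorphM /= Phi0 mul0r rmorphB /= rmorphXn /= => <-.
have [d d_prim dm] := prim_order_exists m_gt0 xm.
have x_neq0 : x != 0.
  by apply/eqP => x0; move/eqP: xm; rewrite x0 expr0n gtn_eqF // eq_sym oner_eq0.
have dp : (d %| p.-1)%N.
  rewrite (prim_order_dvd d_prim); apply/eqP/(mulfI x_neq0).
  by have := expf_card x; rewrite card_Fp // -exprS prednK ?prime_gt0 ?mulr1.
have [lt_dm|] := ltnP d m; last first.
  by move=> le_md; rewrite -(@anti_leq d m) // le_md dvdn_leq.
have [Q] := Cyclotomic_dvd_sum_expX m_gt0 dm lt_dm.
move/(congr1 (fun q : {poly int} => q.[a]%:~R : 'F_p)).
rewrite hornerM rmorphM /= Phi0 mul0r horner_sum rmorph_sum /=.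
under eq_bigr => i _.
  rewrite !hornerE !rmorphXn /= -/x (prim_expr_order d_prim) expr1n.
  over.
rewrite sumr_const card_ord => /eqP md0.
case/negP: pNm; apply: dvdn_trans (dvdn_div dm).
by rewrite (dvdn_pcharf (pchar_Fp p_pr)).
Qed.

(** The values 0, 1 and -1 are taken by P = ['Phi_m] exactly at the roots of P(P^2 - 1), and these
    are too few to contain all multiples of [m]. *)
Lemma exists_nonunit_Cyclotomic (m : nat) : (0 < m)%N ->
  exists k : nat, `|('Phi_m).[(m * k)%:Z]|%N \notin [:: 0%N; 1%N].
Proof.
move=> m_gt0; set P := 'Phi_m; pose Q := P * (P ^+ 2 - 1).
have P_neq0 : P != 0 by rewrite monic_neq0 ?Cyclotomic_monic.
(* The degree of ['Phi_m] is the totient of [m], which is positive. *)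
have P_neqC (c : int) : P != c%:P.
  apply/eqP => /(congr1 (size \o val)) /=.
  rewrite size_Cyclotomic size_polyC; have := totient_gt0 m; rewrite m_gt0.
  by case: (c != 0); lia.
have Q_neq0 : Q != 0.
  by rewrite mulf_neq0 // subr_eq0 sqrf_eq1 negb_or P_neqC -polyCN P_neqC.
pose rs := [seq (m * k)%:Z | k <- iota 0 (size Q)].
have rs_uniq : uniq rs by rewrite map_inj_uniq ?iota_uniq // => i j; nia.
have /allPn[a /mapP[k _ ->] aNroot] : ~~ all (root Q) rs.
  apply/negP => rs_root; have := max_poly_roots Q_neq0 rs_root rs_uniq.
  by rewrite size_map size_iota ltnn.
exists k; move: aNroot; rewrite /root !hornerE !inE -/P.
by rewrite mulf_eq0 subr_eq0 sqrf_eq1; move: P.[_] => v; lia.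
Qed.

Lemma exists_prime_1_mod (m : nat) : (0 < m)%N ->
  exists p, prime p && (m %| p.-1)%N.
Proof.
move=> m_gt0; have [k] := exists_nonunit_Cyclotomic m_gt0.
set n := `|_|%N => n_neq01.
have n_gt1 : (1 < n)%N by move: n_neq01; rewrite !inE; lia.
exists (pdiv n); have p_pr := pdiv_prime n_gt1; rewrite p_pr.
have p_dvd : (pdiv n %| ('Phi_m).[(m * k)%:Z])%Z by exact: pdiv_dvd.
apply: (prime_dvd_Cyclotomic m_gt0 p_pr _ p_dvd).
(* Evaluating at a multiple of [m] pays off here: a prime factor of [m] would divide both (mk)^m and
   (mk)^m - 1, hence 1. *)
apply/negP => pm.
have : (pdiv n %| (m * k)%:Z ^+ m - 1)%Z.
  have := congr1 (horner^~ (m * k)%:Z) (prod_Cyclotomic m_gt0).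
  rewrite (bigD1_seq m) ?divisors_uniq -?dvdn_divisors //= !hornerE => <-.
  exact: dvdz_mulr p_dvd.
have pam : (pdiv n %| (m * k)%:Z ^+ m)%Z.
  by rewrite dvdz_exp // dvdzE dvdn_mulr.
move=> /(rpredB pam); rewrite subKr => p_dvd1.
by have := prime_gt1 p_pr; rewrite ltnNge dvdn_leq.
Qed.

(** Each term [m] is followed by a prime that is 1 mod 4(m + 1)!. The factorial is a multiple of q +
    1 for every q <= m, so the latest term alone takes care of all earlier ones. *)
Lemma prime_sequence_1_mod :
  exists2 p : nat -> nat, (forall i, prime (p i) /\ (4 %| (p i).-1)%N) &
    forall i j, (i < j)%N -> (4 * (p i).+1 %| (p j).-1)%N.
Proof.
have H m : exists p, prime p && (4 * m.+1`! %| p.-1)%N.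
  by apply: exists_prime_1_mod; rewrite muln_gt0 fact_gt0.
pose g m : nat := xchoose (H m).
have g_prime m : prime (g m) by have /andP[] := xchooseP (H m).
have g_mod m : (4 * m.+1`! %| (g m).-1)%N by have /andP[] := xchooseP (H m).
have lt_g m : (m < g m)%N.
  have := dvdn_leq _ (g_mod m); have := prime_gt1 (g_prime m).
  have := fact_geq m.+1; lia.
exists (fun i => iter i g 5%N) => [[|i]|i j].
- by [].
- by rewrite iterS; split=> //; apply: dvdn_trans (g_mod _); apply: dvdn_mulr.
case: j => // j le_ij.
rewrite iterS; apply: dvdn_trans (g_mod _); rewrite dvdn_pmul2l //.
apply: dvdn_fact; rewrite ltnS /=.
(* The sequence is increasing because [g] exceeds its argument. *)
elim: j le_ij => [|j IHj]; first by rewrite ltnS leqn0 => /eqP->.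
rewrite ltnS leq_eqVlt => /orP[/eqP->//|/IHj]/leq_trans; apply.
by rewrite ltnS iterS ltnW.
Qed.

(* With x = 4s + 1 and y = 1 + 4t(x + 1), (x + y)/2 = (2s + 1)(4t + 1). *)
Lemma average_not_prime (x y r : nat) :
    (1 < x)%N -> (4 %| x.-1)%N -> (1 < y)%N -> (4 * x.+1 %| y.-1)%N ->
  (r * 2 = x + y)%N -> ~~ prime r.
Proof.
move=> x_gt1 /dvdnP[s xE] y_gt1 /dvdnP[t yE] rE.
have {}xE : x = (s * 4 + 1)%N by lia.
have -> : r = ((2 * s + 1) * (4 * t + 1))%N by nia.
(* Both factors exceed 1, since x > 1 and y > 1 force s > 0 and t > 0. *)
apply/primeP => -[_ /(_ (2 * s + 1)%N (dvdn_mulr _ (dvdnn _)))].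
by case/orP => /eqP; nia.
Qed.

Lemma prime_numbers_strongly_nonconvex (R : realType) :
  strongly_nonconvex (prime_numbers R).
Proof.
have [p p_pr p_mod] := prime_sequence_1_mod.
have avgN i j r : (i < j)%N -> (r * 2 = p i + p j)%N -> ~~ prime r.
  move=> lt_ij; have [pi_pr pi4] := p_pr i; have [pj_pr _] := p_pr j.
  by apply: average_not_prime; rewrite ?prime_gt1 ?p_mod.
have lt_p i j : (i < j)%N -> (p i < p j)%N.
  move=> /p_mod/dvdn_leq; have /prime_gt1 := (p_pr j).1; lia.
exists (range (fun i => const_mx (p i)%:R)); split.
- by move=> _ [i _ <-]; exists (p i); have [] := p_pr i.
- rewrite (eq_finite_set (inj_card_eq _)); first exact: infinite_nat.
  move=> i j _ _ /matrixP/(_ 0 0)/eqP; rewrite !mxE eqr_nat => /eqP eq_p.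
  by case: (ltngtP i j) => // /lt_p; rewrite eq_p ltnn.
move=> _ _ [i _ <-] [j _ <-] neq_ij [r /= r_pr] /matrixP/(_ 0 0).
rewrite !mxE => rE.
have {}rE : (r * 2 = p i + p j)%N.
  by apply/eqP; rewrite -(eqr_nat R) natrM natrD rE mulrC mulVKf.
have [lt_ij|lt_ji|eq_ij] := ltngtP i j.
- by have := avgN _ _ _ lt_ij rE; rewrite r_pr.
- by have := avgN _ _ _ lt_ji; rewrite addnC => /(_ _ rE); rewrite r_pr.
- by case: neq_ij; rewrite eq_ij.
Qed.

Lemma convex_midpoint (R : realType) (n : nat) (M : set 'rV[R]_n)
    (x y : 'rV[R]_n) :
  convex_set M -> M x -> M y -> M (2^-1 *: (x + y)).
Proof.
move=> M_convex Mx My.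
have half_ge0 : 0 <= 2^-1 :> R by rewrite invr_ge0.
have half_le1 : 2^-1 <= 1 :> R by rewrite invf_le1 // ler1n.
have := M_convex x y (Itv01 half_ge0 half_le1).
rewrite !inE => /(_ Mx My); congr M.
rewrite scalerDr; congr (_ + _ *: _).
by rewrite /unstable.onem /=; field.
Qed.

(* Two of infinitely many points of S have witnesses z, z' congruent mod 2, so
   that (z + z')/2 is again an integer witness. *)
Lemma strongly_nonconvex_not_MICP (R : realType) (n : nat)
    (S : set 'rV[R]_n) :
  strongly_nonconvex S -> ~ MICP_representable S.
Proof.
move=> [T [TS T_inf T_mid]] [p [d [M [_ M_convex SE]]]].
have /choice[w Mw] (x : 'rV[R]_n) : exists w : 'rV[R]_p * 'rV[int]_d,
    S x -> M (row_mx (row_mx x w.1) (map_mx intr w.2)).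
  have [|xNS] := pselect (S x); last by exists (0, 0).
  by rewrite {1}SE => -[y [z Mxyz]]; exists (y, z).
(* Only 2^d parity vectors exist, so [parity] cannot be injective on the infinite set [T]. *)
pose parity x : {ffun 'I_d -> bool} := [ffun i => odd `|(w x).2 0%R i|%N].
have [x [y [Tx Ty neq_xy eq_xy]]] :
    exists x y, [/\ T x, T y, x <> y & parity x = parity y].
  apply: contra_notP T_inf => no_pair.
  have parity_inj : {in T &, injective parity}.
    move=> x y; rewrite !inE => Tx Ty eq_xy.
    by apply: contra_notP no_pair => neq_xy; exists x, y.
  rewrite -(eq_finite_set (inj_card_eq parity_inj)).
  exact: finite_finset.
apply: (T_mid x y Tx Ty neq_xy); rewrite SE.
(* Equal parities make this integer division exact in every coordinate. *)
pose z := \row_i (((w x).2 0%R i + (w y).2 0%R i) %/ 2)%Z.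
exists (2^-1 *: ((w x).1 + (w y).1)), z.
have -> : map_mx intr z =
    2^-1 *: (map_mx intr (w x).2 + map_mx intr (w y).2) :> 'rV[R]_d.
  apply/rowP => i; rewrite !mxE -rmorphD /=.
  have dvd2 : (2 %| (w x).2 0%R i + (w y).2 0%R i)%Z.
    have := congr1 (fun f : {ffun 'I_d -> bool} => f i) eq_xy.
    by rewrite !ffunE; lia.
  by rewrite -{2}(divzK dvd2) rmorphM /= mulrC mulfK ?intr_eq0.
rewrite -!scale_row_mx -!add_row_mx.
by apply: convex_midpoint => //; apply/Mw/TS.
Qed.

Theorem theorem3 (R : realType) :
  strongly_nonconvex (prime_numbers R) /\
  ~ MICP_representable (prime_numbers R).
Proof.
have S_nonconvex := @prime_numbers_strongly_nonconvex R.
by split=> //; apply: strongly_nonconvex_not_MICP.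
Qed.
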